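(* Fix a dimension $d\ge 1$ (stochastic and deterministic CA on $\mathbb{Z}^d$). Let $\mathcal{P}_N$ be the decision problem: given two stochastic CA with the same set of states, do they have the same non-deterministic global function? Let $\mathcal{P}_S$ be the decision problem: given two stochastic CA with the same set of states, do they have the same stochastic global function? Then the surjectivity problem for classical deterministic cellular automata (given a deterministic CA $F:Q^{\mathbb{Z}^d}\to Q^{\mathbb{Z}^d}$, is $F$ surjective?) is (computably) reducible to $\mathcal{P}_N$ and also to $\mathcal{P}_S$.
   Context: A stochastic cellular automaton (stochastic CA) is a tuple $(Q,R,V,V',f)$ where $Q$ is a finite set of states, $R$ a finite set of random symbols, $V=\{v_1,\dots,v_r\}$ and $V'=\{v'_1,\dots,v'_{r'}\}$ finite subsets of $\mathbb{Z}$ (neighborhoods), and $f:Q^r\times R^{r'}\to Q$ a local transition function. Its explicit global function $F:Q^{\mathbb{Z}}\times R^{\mathbb{Z}}\to Q^{\mathbb{Z}}$ is $F(c,s)_z=f\big((c_{z+v_1},\dots,c_{z+v_r}),(s_{z+v'_1},\dots,s_{z+v'_{r'}})\big)$ (in dimension $d$ the same definitions are used with $\mathbb{Z}$ replaced by $\mathbb{Z}^d$). Cylinders are $[u]_z=\{c: c_{z+x}=u_x \text{ for } 0\le x<|u|\}$; $\nu_R$ denotes the uniform Bernoulli measure on $R^{\mathbb{Z}}$. The non-deterministic global function is $N_F(c)=\{F(c,s): s\in R^{\mathbb{Z}}\}$. The stochastic global function $S_F:Q^{\mathbb{Z}}\to\mathcal{M}(Q^{\mathbb{Z}})$ (Borel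 probability measures) is given by $S_F(c)([u]_z)=\nu_R(\{s\in R^{\mathbb{Z}}: F(c,s)\in[u]_z\})$, i.e. $S_F(c)$ is the law of $F(c,s)$ for $s$ uniformly random. *)

(* Defs.v *)
From HB Require Import structures.
From mathcomp Require Import all_boot all_order all_algebra.
Set Implicit Arguments. Unset Strict Implicit. Unset Printing Implicit Defensive.
Import Order.TTheory GRing.Theory Num.Theory.
Local Open Scope ring_scope.

(* Arguments are passed as a list; missing arguments default to 0.    *)
Inductive recf : Type :=
  | RZero : recf
  | RSucc : recf
  | RProj : nat -> recf
  | RComp : recf -> seq recf -> recf
  | RPrimRec : recf -> recf -> recf
  | RMu : recf -> recf.

Inductive reval : recf -> seq nat -> nat -> Prop :=
  | ev_zero xs : reval RZero xs 0
  | ev_succ x xs : reval RSucc (x :: xs) x.+1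
  | ev_proj i xs : reval (RProj i) xs (nth 0%N xs i)
  | ev_comp f gs xs ys y :
      revals gs xs ys -> reval f ys y -> reval (RComp f gs) xs y
  | ev_pr0 f g xs y : reval f xs y -> reval (RPrimRec f g) (0%N :: xs) y
  | ev_prS f g n xs y z :
      reval (RPrimRec f g) (n :: xs) y -> reval g [:: n, y & xs] z ->
      reval (RPrimRec f g) (n.+1 :: xs) z
  | ev_mu f xs n :
      reval f (n :: xs) 0 ->
      (forall m, (m < n)%N -> exists k, reval f (m :: xs) k.+1) ->
      reval (RMu f) xs n
with revals : seq recf -> seq nat -> seq nat -> Prop :=
  | evs_nil xs : revals [::] xs [::]
  | evs_cons g gs xs y ys :
      reval g xs y -> revals gs xs ys -> revals (g :: gs) xs (y :: ys).

Definition reduces (A B : countType) (validA : A -> Prop) (PA : A -> Prop)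
    (validB : B -> Prop) (PB : B -> Prop) : Prop :=
  exists p : recf, forall a : A, validA a ->
    exists y : nat, reval p [:: pickle a] y /\
      exists b : B, unpickle y = Some b /\ validB b /\ (PA a <-> PB b).

Definition cell (d : nat) := 'rV[int]_d.

Definition detCA (d : nat) : countType :=
  {q : nat & {V : seq (cell d) & {ffun (size V).-tuple 'I_q -> 'I_q}}}.

Definition dq d (D : detCA d) : nat := tag D.
Definition dV d (D : detCA d) : seq (cell d) := tag (tagged D).
Definition df d (D : detCA d) :
  {ffun (size (dV D)).-tuple 'I_(dq D) -> 'I_(dq D)} := tagged (tagged D).

Definition det_valid d (D : detCA d) : Prop := uniq (dV D).

Definition det_global d (D : detCA d) (c : cell d -> 'I_(dq D)) :
    cell d -> 'I_(dq D) :=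
  fun z => df D (map_tuple (fun v => c (z + v)) (in_tuple (dV D))).

Arguments det_global {d} D c z.

Definition det_surjective d (D : detCA d) : Prop :=
  forall e : cell d -> 'I_(dq D), exists c, det_global D c = e.

(* Stochastic CA with states 'I_q: random symbols R = 'I_k.+1 (nonempty),
   neighborhoods V, V', local rule f : Q^r * R^r' -> Q. *)
Definition sca (d q : nat) : countType :=
  {k : nat & {V : seq (cell d) & {V' : seq (cell d) &
     {ffun ((size V).-tuple 'I_q * (size V').-tuple 'I_k.+1)%type -> 'I_q}}}}.

Section SCA.
Variables (d q : nat).
Definition sk (A : sca d q) : nat := tag A.
Definition sV (A : sca d q) : seq (cell d) := tag (tagged A).
Definition sV' (A : sca d q) : seq (cell d) := tag (tagged (tagged A)).
Definition sf (A : sca d q) :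
  {ffun ((size (sV A)).-tuple 'I_q * (size (sV' A)).-tuple 'I_(sk A).+1)%type
        -> 'I_q} := tagged (tagged (tagged A)).

Definition sca_valid (A : sca d q) : Prop := uniq (sV A) /\ uniq (sV' A).

Definition st_global (A : sca d q) (c : cell d -> 'I_q)
    (s : cell d -> 'I_(sk A).+1) : cell d -> 'I_q :=
  fun z => sf A (map_tuple (fun v => c (z + v)) (in_tuple (sV A)),
                 map_tuple (fun v => s (z + v)) (in_tuple (sV' A))).


Definition nondet_global (A : sca d q) (c : cell d -> 'I_q) :
    (cell d -> 'I_q) -> Prop :=
  fun e => exists s : cell d -> 'I_(sk A).+1, @st_global A c s = e.

(* Stochastic global function, evaluated on the cylinder
   { e | e z = u z for all z in D } (D a finite domain): the
   nu_R-measure of { s | F(c,s) in cylinder }.  This event depends only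
   on s restricted to the finite window W = D + V', so its uniform
   Bernoulli measure is (#good assignments on W) / |R|^|W|. *)
Definition window (A : sca d q) (D : seq (cell d)) : seq (cell d) :=
  undup [seq z + v | z <- D, v <- sV' A].

Definition ext_assign (A : sca d q) (W : seq (cell d))
    (a : (size W).-tuple 'I_(sk A).+1) : cell d -> 'I_(sk A).+1 :=
  fun x => nth ord0 a (index x W).

Definition cyl_prob (A : sca d q) (c : cell d -> 'I_q) (D : seq (cell d))
    (u : cell d -> 'I_q) : rat :=
  let W := window A D in
  (#|[pred a : (size W).-tuple 'I_(sk A).+1 |
       all (fun z => @st_global A c (ext_assign a) z == u z) D]|)%:R
  / ((sk A).+1 ^ size W)%:R.

Definition same_nondet (A B : sca d q) : Prop :=
  forall c : cell d -> 'I_q, nondet_global A c = nondet_global B c.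

Definition same_stoch (A B : sca d q) : Prop :=
  forall (c : cell d -> 'I_q) (D : seq (cell d)) (u : cell d -> 'I_q),
    cyl_prob A c D u = cyl_prob B c D u.
End SCA.
Arguments st_global {d q} A c s z.

Definition pinst (d : nat) : countType := {q : nat & (sca d q * sca d q)%type}.

Definition pinst_valid d (I : pinst d) : Prop :=
  sca_valid (tagged I).1 /\ sca_valid (tagged I).2.

Definition P_N d (I : pinst d) : Prop := same_nondet (tagged I).1 (tagged I).2.
Definition P_S d (I : pinst d) : Prop := same_stoch (tagged I).1 (tagged I).2.

(* Main.v *)
Require Import Defs.
From mathcomp Require Import all_boot all_order all_algebra.
From mathcomp Require Import boolp zify.
Import Order.TTheory GRing.Theory Num.Theory.
Set Implicit Arguments. Unset Strict Implicit. Unset Printing Implicit Defensive.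

(** A deterministic CA with local rule [g] on the neighborhood [V] is turned
    into two stochastic CA which ignore the configuration and read the random
    symbols on [V]: the first one applies [g] to them, the second one outputs
    the symbol at the first cell of [V], that is, a shift of the noise. The
    non-deterministic images are the range of the deterministic global map [G]
    and the full space; the laws are the image by [G] of the uniform measure
    and the uniform measure itself. If the laws agree, every finite pattern has
    a preimage and compactness gives surjectivity. Conversely, if [G] is
    surjective and some finite pattern had fewer preimages than the average,
    imposing it on a positive density of disjoint translates inside a large box
    would multiply the number of preimage patterns by an exponentially small
    factor in the volume relative to the number of images, while the boundary
    of the box can only compensate an exponential in the surface. *)

(** * Recursive functions *)

Definition computable (n : nat) (f : seq nat -> nat) : Prop :=
  exists p, forall xs, size xs = n -> reval p xs (f xs).

Lemma computable_proj n i : computable n (fun xs => nth 0 xs i).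
Proof. by exists (RProj i) => xs _; apply: ev_proj. Qed.

Lemma computable_ext n f g :
  (forall xs, size xs = n -> f xs = g xs) -> computable n f -> computable n g.
Proof. by move=> fg [p Hp]; exists p => xs nxs; rewrite -fg //; apply: Hp. Qed.

Lemma computable_succ n f : computable n f -> computable n (fun xs => (f xs).+1).
Proof.
move=> [p Hp]; exists (RComp RSucc [:: p]) => xs nxs.
apply: (ev_comp (ys := [:: f xs])); last exact: ev_succ.
by apply: evs_cons; [exact: Hp | exact: evs_nil].
Qed.

Lemma computable_const n c : computable n (fun=> c).
Proof.
elim: c => [|c IH]; first by exists RZero => xs _; apply: ev_zero.
exact: computable_succ IH.
Qed.

Lemma computable_comp1 n f g : computable 1 f -> computable n g ->
  computable n (fun xs => f [:: g xs]).
Proof.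
move=> [p Hp] [q Hq]; exists (RComp p [:: q]) => xs nxs.
apply: (ev_comp (ys := [:: g xs])); last exact: Hp.
by apply: evs_cons; [exact: Hq | exact: evs_nil].
Qed.

Lemma computable_comp2 n f g h :
  computable 2 f -> computable n g -> computable n h ->
  computable n (fun xs => f [:: g xs; h xs]).
Proof.
move=> [p Hp] [q Hq] [r Hr]; exists (RComp p [:: q; r]) => xs nxs.
apply: (ev_comp (ys := [:: g xs; h xs])); last exact: Hp.
apply: evs_cons; first exact: Hq.
by apply: evs_cons; [exact: Hr | exact: evs_nil].
Qed.

Lemma computable_rec n f g m :
  computable n m -> computable n f -> computable n.+2 g ->
  computable n (fun xs => nat_rect (fun=> nat) (f xs)
                            (fun i r => g [:: i, r & xs]) (m xs)).
Proof.
move=> [pm Hm] [pf Hf] [pg Hg].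
exists (RComp (RPrimRec pf pg) (pm :: mkseq RProj n)) => xs nxs.
apply: (ev_comp (ys := m xs :: xs)).
  apply: evs_cons; first exact: Hm.
  (* Only the output copy of [xs] is expanded, so that the induction on [iota 0 n] keeps the input
     fixed. *)
  have -> : xs = mkseq (nth 0 xs) n by rewrite -nxs mkseq_nth.
  rewrite {1}(_ : mkseq (nth 0 xs) n = xs); last by rewrite -nxs mkseq_nth.
  rewrite /mkseq; elim: (iota 0 n) => [|i s IH] /=; first exact: evs_nil.
  by apply: evs_cons => //; apply: ev_proj.
elim: (m xs) => [|k IH] /=; first by apply: ev_pr0; exact: Hf.
by apply: ev_prS; [exact: IH | apply: Hg; rewrite /= nxs].
Qed.

Definition computable1 (h : nat -> nat) := forall n f,
  computable n f -> computable n (fun xs => h (f xs)).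
Definition computable2 (h : nat -> nat -> nat) := forall n f g,
  computable n f -> computable n g -> computable n (fun xs => h (f xs) (g xs)).

Lemma computable1P h : computable 1 (fun xs => h (nth 0 xs 0)) -> computable1 h.
Proof. by move=> Hh n f Hf; apply: (computable_comp1 Hh Hf). Qed.

Lemma computable2P h :
  computable 2 (fun xs => h (nth 0 xs 0) (nth 0 xs 1)) -> computable2 h.
Proof. by move=> Hh n f g Hf Hg; apply: (computable_comp2 Hh Hf Hg). Qed.

Lemma computable_predn : computable1 predn.
Proof.
apply: computable1P; have p i := computable_proj 3 i.
apply: computable_ext (computable_rec (computable_proj 1 0)
  (computable_const 1 0) (p 0)).
by move=> xs _; case: (nth 0 xs 0).
Qed.

Lemma computable_add : computable2 addn.
Proof.
apply: computable2P; apply: computable_ext (computable_rec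
  (computable_proj 2 1) (computable_proj 2 0)
  (computable_succ (computable_proj 4 1))).
by move=> xs _; elim: (nth 0 xs 1) => [|k IH] /=; rewrite ?addn0 // IH addnS.
Qed.

Lemma computable_sub : computable2 subn.
Proof.
apply: computable2P; apply: computable_ext (computable_rec
  (computable_proj 2 1) (computable_proj 2 0)
  (computable_predn (computable_proj 4 1))).
by move=> xs _; elim: (nth 0 xs 1) => [|k IH] /=; rewrite ?subn0 // IH subnS.
Qed.

Lemma computable_mul : computable2 muln.
Proof.
apply: computable2P; apply: computable_ext (computable_rec
  (computable_proj 2 1) (computable_const 2 0)
  (computable_add (computable_proj 4 1) (computable_proj 4 2))).
by move=> xs _; elim: (nth 0 xs 1) => [|k IH] /=; rewrite ?muln0 // IH mulnSr.
Qed.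

Lemma computable_exp2 : computable1 (expn 2).
Proof.
apply: computable1P; apply: computable_ext (computable_rec
  (computable_proj 1 0) (computable_const 1 1)
  (computable_add (computable_proj 3 1) (computable_proj 3 1))).
by move=> xs _; elim: (nth 0 xs 0) => [|k IH] //=; rewrite IH expnS mul2n addnn.
Qed.

(** The branches are weighted by [1 - b] and [1 - (1 - b)]. Both get evaluated, which is harmless as
    all functions involved are total. *)
Lemma computable_if n b f g :
  computable n b -> computable n f -> computable n g ->
  computable n (fun xs => if b xs is 0 then f xs else g xs).
Proof.
move=> Hb Hf Hg.
have nb : computable n (fun xs => 1 - b xs).
  exact: computable_sub (computable_const _ _) Hb.
have nnb : computable n (fun xs => 1 - (1 - b xs)).
  exact: computable_sub (computable_const _ _) nb.
apply: computable_ext (computable_add (computable_mul nb Hf)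
  (computable_mul nnb Hg)).
by move=> xs _; case: (b xs) => [|k]; rewrite ?mul1n ?addn0.
Qed.

Lemma computable_odd : computable1 odd.
Proof.
apply: computable1P; apply: computable_ext (computable_rec
  (computable_proj 1 0) (computable_const 1 0)
  (computable_sub (computable_const 3 1) (computable_proj 3 1))).
by move=> xs _; elim: (nth 0 xs 0) => [|k IH] //=; rewrite IH; case: (odd k).
Qed.

Lemma computable_half : computable1 half.
Proof.
apply: computable1P; apply: computable_ext (computable_rec
  (computable_proj 1 0) (computable_const 1 0)
  (computable_add (computable_odd (computable_proj 3 0)) (computable_proj 3 1))).
move=> xs _; elim: (nth 0 xs 0) => [|k IH] //=; rewrite IH.
by rewrite uphalf_half.
Qed.

(** * Arithmetic of list codes *)

Definition halve_even (k m : nat) : nat :=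
  nat_rect (fun=> nat) m (fun _ r => if odd r : nat is 0 then r./2 else r) k.
(** The code of [n :: s] is [code_cons n] applied to the code of [s], so the head is a 2-adic
    valuation: the number of halving steps that still find an even number. *)
Definition code_head (m : nat) : nat :=
  nat_rect (fun=> nat) 0 (fun k r => r + (1 - odd (halve_even k m))) m.
Definition code_tail (m : nat) : nat := (halve_even m m)./2.
Definition code_cons (n m : nat) : nat := 2 ^ n * m.*2.+1.

Lemma odd_code_cons n m : odd (code_cons n m) = (n == 0).
Proof. by rewrite /code_cons oddM oddX /= odd_double andbT orbF. Qed.

Lemma halve_even_cons k n m :
  halve_even k (code_cons n m) = code_cons (n - k) m.
Proof.
elim: k => [|k IH] /=; first by rewrite subn0.
rewrite IH subnS odd_code_cons; case: (n - k) => [|j] //=.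
by rewrite /code_cons expnS -mulnA mul2n doubleK.
Qed.

Lemma code_cons_gt n m : n < code_cons n m /\ m < code_cons n m.
Proof.
split; rewrite /code_cons.
  by apply: leq_trans (ltn_expl n (isT : 1 < 2)) _; rewrite leq_pmulr.
by apply: leq_trans (leq_pmull _ _); rewrite ?expn_gt0 // ltnS -addnn leq_addr.
Qed.

Lemma code_tail_cons n m : code_tail (code_cons n m) = m.
Proof.
rewrite /code_tail halve_even_cons (eqP (ltnW (code_cons_gt n m).1)) /code_cons.
by rewrite mul1n /= uphalf_double.
Qed.

Lemma code_head_cons n m : code_head (code_cons n m) = n.
Proof.
rewrite /code_head.
(* The loop bound is generalised: the count grows with [k] until it is capped at [n], and the actual
   bound exceeds [n]. *)
have H k : nat_rect (fun=> nat) 0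
    (fun i r => r + (1 - odd (halve_even i (code_cons n m)))) k = minn k n.
  elim: k => [|k IH] /=; first by rewrite min0n.
  rewrite IH halve_even_cons odd_code_cons subn_eq0.
  by case: (leqP n k) => /=; lia.
by rewrite H; apply/minn_idPr/ltnW; case: (code_cons_gt n m).
Qed.

Lemma computable_halve_even : computable2 halve_even.
Proof.
apply: computable2P; apply: (computable_rec
  (g := fun xs => if odd (nth 0 xs 1) : nat is 0 then (nth 0 xs 1)./2
                  else nth 0 xs 1)
  (computable_proj 2 0) (computable_proj 2 1)).
have c := computable_proj 4 1.
exact: computable_if (computable_odd c) (computable_half c) c.
Qed.

Lemma computable_code_head : computable1 code_head.
Proof.
apply: computable1P; apply: (computable_rec
  (g := fun xs => nth 0 xs 1 +
     (1 - odd (halve_even (nth 0 xs 0) (nth 0 xs 2))))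
  (computable_proj 1 0) (computable_const 1 0)).
apply: computable_add (computable_proj _ _) _.
apply: computable_sub (computable_const _ _) _; apply: computable_odd.
exact: computable_halve_even (computable_proj _ _) (computable_proj _ _).
Qed.

Lemma computable_code_tail : computable1 code_tail.
Proof.
move=> n f Hf; apply: (@computable_half n (fun xs => halve_even (f xs) (f xs))).
exact: computable_halve_even.
Qed.

Lemma computable_code_cons : computable2 code_cons.
Proof.
move=> n f g Hf Hg; apply: computable_mul (computable_exp2 Hf) _.
apply: computable_succ.
apply: computable_ext (computable_add Hg Hg) => xs _; exact: addnn.
Qed.

Definition code_drop (k m : nat) : nat :=
  nat_rect (fun=> nat) m (fun _ => code_tail) k.

Lemma code_drop_code k s : code_drop k (CodeSeq.code s) = CodeSeq.code (drop k s).
Proof.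
elim: k => [|k IH] /=; first by rewrite drop0.
rewrite IH -addn1 addnC -drop_drop.
by case: (drop k s) => [|x t] //=; rewrite drop0 code_tail_cons.
Qed.

Lemma computable_code_drop : computable2 code_drop.
Proof.
apply: computable2P; apply: (computable_rec
  (g := fun xs => code_tail (nth 0 xs 1))
  (computable_proj 2 0) (computable_proj 2 1)).
exact: computable_code_tail (computable_proj _ _).
Qed.

(* Builds the image list from its end: after [i] steps the accumulator codes
   the image of the last [i] entries, counted from the bound [m] on the
   length of the list coded by [m]. *)
Definition code_map (h : nat -> nat) (m : nat) : nat :=
  nat_rect (fun=> nat) 0 (fun i r => let t := code_drop (m - i.+1) m in
     if t is 0 then r else code_cons (h (code_head t)) r) m.

Lemma size_code s : size s <= CodeSeq.code s.
Proof.
elim: s => [|n s IH] //=.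
exact: leq_ltn_trans IH (code_cons_gt n (CodeSeq.code s)).2.
Qed.

Lemma code_mapE h s : code_map h (CodeSeq.code s) = CodeSeq.code (map h s).
Proof.
rewrite /code_map; set m := CodeSeq.code s.
suff H i : i <= m -> nat_rect (fun=> nat) 0 (fun i r =>
    let t := code_drop (m - i.+1) m in
    if t is 0 then r else code_cons (h (code_head t)) r) i =
    CodeSeq.code (map h (drop (m - i) s)) by rewrite H // subnn drop0.
elim: i => [|i IH] /= im; first by rewrite subn0 drop_oversize // size_code.
rewrite IH; last exact: ltnW.
rewrite code_drop_code (_ : m - i = 1 + (m - i.+1)); last by lia.
rewrite -drop_drop; case: (drop _ s) => [|x t] //.
rewrite [CodeSeq.code (x :: t)](_ : _ = code_cons x (CodeSeq.code t)) //.
case E: (code_cons x _) => [|k].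
  by have := (code_cons_gt x (CodeSeq.code t)).1; rewrite E.
by rewrite -E code_head_cons /= drop0.
Qed.

Lemma computable_code_map h : computable1 h -> computable1 (code_map h).
Proof.
move=> Hh; apply: computable1P; apply: (computable_rec
  (g := fun xs => if code_drop (nth 0 xs 2 - (nth 0 xs 0).+1) (nth 0 xs 2)
                  is 0 then nth 0 xs 1
                  else code_cons (h (code_head
             (code_drop (nth 0 xs 2 - (nth 0 xs 0).+1) (nth 0 xs 2))))
              (nth 0 xs 1))
  (computable_proj 1 0) (computable_const 1 0)).
have c0 := computable_proj 3 0; have c1 := computable_proj 3 1.
have c2 := computable_proj 3 2.
have cd := computable_code_drop (computable_sub c2 (computable_succ c0)) c2.
apply: (computable_if cd c1); refine (computable_code_cons _ c1).
exact/Hh/computable_code_head.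
Qed.

(** * The reduction on codes *)

Section NoiseCA.
Variables (d k : nat).
Implicit Type V : seq (cell d).

Definition noise_sca V (h : (size V).-tuple 'I_k.+1 -> 'I_k.+1) : sca d k.+1 :=
  existT _ k (existT _ [::] (existT _ V [ffun x => h x.2])).

Definition rule_global V (h : (size V).-tuple 'I_k.+1 -> 'I_k.+1)
    (s : cell d -> 'I_k.+1) (z : cell d) : 'I_k.+1 :=
  h (map_tuple (fun v => s (z + v)%R) (in_tuple V)).

Lemma st_global_noise V h c s :
  @st_global d k.+1 (@noise_sca V h) c s = @rule_global V h s.
Proof. by apply: funext => z; rewrite /st_global ffunE. Qed.

Definition noise_pinst V g h : pinst d :=
  existT _ k.+1 (@noise_sca V g, @noise_sca V h).

End NoiseCA.

(** A finite function is coded through its graph: each entry carries its own argument and can be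
    recoded without knowing its position. *)
Lemma pickle_ffun (aT : finType) (rT : countType) (f : {ffun aT -> rT}) :
  pickle f =
  CodeSeq.code [seq CodeSeq.code [:: pickle x; pickle (f x)] | x <- enum aT].
Proof.
transitivity (CodeSeq.code (map pickle (codom (total_fun f)))); first by [].
by rewrite codomE -map_comp.
Qed.

(** The empty configuration neighborhood leaves a trivial factor in the domain of the local rule.
    Its removal preserves the enumeration order, so the stochastic and deterministic tables list
    their entries in the same order. *)
Lemma enum_pair0 (n : nat) (T S : finType) (t0 := [tuple] : 0.-tuple S) :
  enum {: 0.-tuple S * n.-tuple T} = map (pair t0) (enum {: n.-tuple T}).
Proof.
have e0 : enum {: 0.-tuple S} = [:: t0].
  have : size (enum {: 0.-tuple S}) = 1 by rewrite -cardE card_tuple.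
  by case: (enum _) => [|x []] //= _; rewrite (tuple0 x).
rewrite !enumT in e0 *.
transitivity (prod_enum (0.-tuple S) (n.-tuple T)); first by rewrite !unlock.
by rewrite /prod_enum !enumT e0 /= cats0.
Qed.

Lemma pickle_noise d k (V : seq (cell d)) h :
  pickle (@noise_sca d k V h) =
  CodeSeq.code [:: k; CodeSeq.code [:: 0; CodeSeq.code [:: pickle V;
    CodeSeq.code [seq CodeSeq.code [:: CodeSeq.code [:: 0; pickle x];
                                       nat_of_ord (h x)]
    | x <- enum {: (size V).-tuple 'I_k.+1}]]]].
Proof.
transitivity (CodeSeq.code [:: k; CodeSeq.code [:: 0; CodeSeq.code [:: pickle V;
  pickle [ffun x : (0.-tuple 'I_k.+1 * (size V).-tuple 'I_k.+1)%type => h x.2]]]]) => //.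
rewrite pickle_ffun (enum_pair0 _ 'I_k.+1 'I_k.+1) -map_comp.
by do ![congr CodeSeq.code | congr (_ :: _)]; apply: eq_map => x /=; rewrite ffunE.
Qed.

Lemma pickle_detCA d q (V : seq (cell d)) (g : {ffun (size V).-tuple 'I_q -> 'I_q}) :
  pickle (existT _ q (existT _ V g) : detCA d) =
  CodeSeq.code [:: q; CodeSeq.code [:: pickle V;
    CodeSeq.code [seq CodeSeq.code [:: pickle x; nat_of_ord (g x)]
    | x <- enum {: (size V).-tuple 'I_q}]]].
Proof.
transitivity (CodeSeq.code [:: q; CodeSeq.code [:: pickle V; pickle g]]) => //.
by rewrite pickle_ffun.
Qed.

Lemma pickle_tuple_head n q (x : n.-tuple 'I_q.+1) :
  0 < n -> code_head (pickle x) = nth ord0 x 0.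
Proof.
case: n x => // n x _; case/tupleP: x => a x.
exact: code_head_cons a (CodeSeq.code (map pickle x)).
Qed.

Definition pair_code (a b : nat) : nat := code_cons a (code_cons b 0).

(* The enumeration order of tuples is abstract, hence so is the order of the
   entries of a coded transition table: tables may only be transformed entry by
   entry, which is why both stochastic CA keep the neighborhood of the
   deterministic one. *)
Definition recode_entry (out : nat -> nat) (e : nat) : nat :=
  pair_code (pair_code 0 (code_head e)) (out e).

Definition recode_sca (out : nat -> nat) (k w t : nat) : nat :=
  pair_code k (pair_code 0 (pair_code w (code_map (recode_entry out) t))).

(** With at most one state every CA is surjective; with more states and an empty neighborhood (code
    [w = 0]) the images are constant configurations and surjectivity fails. These cases get fixed
    instances; otherwise there is a first cell to read. *)
Definition reduction (yes no m : nat) : nat :=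
  let q := code_head m in
  let body := code_head (code_tail m) in
  let w := code_head body in
  let t := code_head (code_tail body) in
  if q.-1 is 0 then yes else
  if w is 0 then no else
  pair_code q (pair_code
    (recode_sca (fun e => code_head (code_tail e)) q.-1 w t)
    (recode_sca (fun e => code_head (code_head e)) q.-1 w t)).

Lemma computable_pair_code : computable2 pair_code.
Proof.
move=> n f g Hf Hg; apply: (computable_code_cons Hf).
exact: (computable_code_cons Hg (computable_const n 0)).
Qed.

Lemma computable_recode_sca out : computable1 out ->
  forall n f g h, computable n f -> computable n g -> computable n h ->
  computable n (fun xs => recode_sca out (f xs) (g xs) (h xs)).
Proof.
move=> Hout n f g h Hf Hg Hh; apply: (computable_pair_code Hf).
apply: (computable_pair_code (computable_const n 0)).
apply: (computable_pair_code Hg); apply: computable_code_map => // i e He.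
refine (computable_pair_code _ (Hout _ _ He)).
exact: (computable_pair_code (computable_const i 0) (computable_code_head He)).
Qed.

Lemma computable_reduction yes no :
  computable 1 (fun xs => reduction yes no (nth 0 xs 0)).
Proof.
have cm := computable_proj 1 0; have cq := computable_code_head cm.
have cb := computable_code_head (computable_code_tail cm).
have cw := computable_code_head cb.
have ct := computable_code_head (computable_code_tail cb).
have ck := computable_predn cq.
apply: (computable_if ck (computable_const 1 yes)).
apply: (computable_if cw (computable_const 1 no)).
apply: (computable_pair_code cq); apply: computable_pair_code.
  apply: (computable_recode_sca _ ck cw ct) => n f Hf.
  exact/computable_code_head/computable_code_tail.
apply: (computable_recode_sca _ ck cw ct) => n f Hf.
exact/computable_code_head/computable_code_head.
Qed.

Lemma reduction_code yes no q w t :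
  reduction yes no (CodeSeq.code [:: q; CodeSeq.code [:: w; t]]) =
  if q.-1 is 0 then yes else
  if w is 0 then no else
  pair_code q (pair_code
    (recode_sca (fun e => code_head (code_tail e)) q.-1 w t)
    (recode_sca (fun e => code_head (code_head e)) q.-1 w t)).
Proof.
rewrite /reduction; do !rewrite [CodeSeq.code (_ :: _)]/(code_cons _ _).
by rewrite !(code_head_cons, code_tail_cons).
Qed.

Lemma code_cons_neq0 n m : code_cons n m <> 0.
Proof. by move=> e; have := (code_cons_gt n m).1; rewrite e. Qed.

(** * Correctness of the reduction on codes *)

Section Reduction.
Variable d : nat.

Definition tuple_head k n (x : n.-tuple 'I_k.+1) : 'I_k.+1 := nth ord0 x 0.

Definition no_pinst : pinst d :=
  @noise_pinst d 1 [::] (fun=> ord0) (fun=> ord_max).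

Definition yes_pinst : pinst d :=
  @noise_pinst d 0 [::] (fun=> ord0) (fun=> ord0).

Lemma pickle_noise_pinst k V g h : pickle (@noise_pinst d k V g h) =
  pair_code k.+1 (pair_code (pickle (@noise_sca d k V g)) (pickle (@noise_sca d k V h))).
Proof. by []. Qed.

Lemma recode_noise k (V : seq (cell d)) h (g : _ -> 'I_k.+1) out :
  (forall x, out (pair_code (pickle x) (g x)) = nat_of_ord (h x)) ->
  recode_sca out k (pickle V)
    (CodeSeq.code [seq pair_code (pickle x) (g x)
                  | x <- enum {: (size V).-tuple 'I_k.+1}])
  = pickle (@noise_sca d k V h).
Proof.
move=> outE; rewrite pickle_noise /recode_sca code_mapE -map_comp.
do 3 congr (pair_code _ _); congr CodeSeq.code; apply: eq_map => x /=.
by rewrite /recode_entry outE /pair_code code_head_cons.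
Qed.

Lemma reduction_noise k v V (g : {ffun (size (v :: V)).-tuple 'I_k.+2 -> 'I_k.+2}) :
  reduction (pickle yes_pinst) (pickle no_pinst)
    (pickle (existT _ k.+2 (existT _ (v :: V) g) : detCA d)) =
  pickle (@noise_pinst d k.+1 (v :: V) g (@tuple_head k.+1 (size V).+1)).
Proof.
rewrite pickle_noise_pinst pickle_detCA.
rewrite -(@recode_noise _ (v :: V) g g (fun e => code_head (code_tail e))); last first.
  by move=> x; rewrite /pair_code code_tail_cons code_head_cons.
rewrite -(@recode_noise _ (v :: V) _ g (fun e => code_head (code_head e))); last first.
  by move=> x; rewrite /pair_code code_head_cons pickle_tuple_head.
rewrite reduction_code.
have : pickle (v :: V) <> 0 by exact: code_cons_neq0.
case E: (pickle (v :: V)) => [|w] // _.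
Qed.

(** Common to both problems: what remains to be checked for each is its value on the two fixed
    instances and the equivalence for nonempty neighborhoods. *)
Lemma reduces_noise (P : pinst d -> Prop) :
  P yes_pinst -> ~ P no_pinst ->
  (forall k V (g : {ffun (size V).-tuple 'I_k.+1 -> 'I_k.+1}), V <> [::] ->
     (forall e, exists c, @rule_global d k V g c = e) <->
     P (@noise_pinst d k V g (@tuple_head k (size V)))) ->
  reduces (@det_valid d) (@det_surjective d) (@pinst_valid d) P.
Proof.
move=> Pyes Pno Pnoise.
have [p Hp] := computable_reduction (pickle yes_pinst) (pickle no_pinst).
exists p => D Dval; eexists; split; first exact: Hp.
rewrite [nth _ _ _]/=; case: D Dval => q [V g] Vuniq.
pose D : detCA d := existT _ q (existT _ V g).
case: q V g => [|[|k]] V g in Vuniq D *.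
- exists yes_pinst; split; last by split => //; split => // _ e; case: (e 0%R).
  rewrite -pickleK; congr unpickle; by rewrite pickle_detCA reduction_code.
- exists yes_pinst; split.
    rewrite -pickleK; congr unpickle; by rewrite pickle_detCA reduction_code.
  split=> //; split => // _ e; exists e; apply: funext => z.
  by rewrite [LHS]ord1 [RHS]ord1.
case: V g => [|v V] g in Vuniq D *.
  exists no_pinst; split.
    rewrite -pickleK; congr unpickle; by rewrite pickle_detCA reduction_code.
  split=> //; split=> // surj.
  (* Without neighbors [g] is only ever applied to the empty tuple, so the two constant
     configurations cannot both be images. *)
  have [c /(congr1 (fun e => e 0%R)) c0] := surj (fun=> ord0).
  have [c' /(congr1 (fun e => e 0%R)) c1] := surj (fun=> ord_max).
  suff : (ord0 : 'I_k.+2) = ord_max by [].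
  rewrite -c0 -c1 /det_global; congr (fun_of_fin _ _).
  by apply: val_inj.
exists (@noise_pinst d k.+1 (v :: V) g (@tuple_head k.+1 (size V).+1)).
split; first by rewrite reduction_noise pickleK.
by split; [split | exact: Pnoise].
Qed.
End Reduction.

(** * Compactness *)

Section Compactness.
Variables (T : countType) (Q : finType) (P : nat -> (T -> Q) -> Prop).
Hypothesis P_anti : forall n s, P n.+1 s -> P n s.
Hypothesis P_nonempty : forall n, exists s, P n s.
Hypothesis P_local : forall n, exists D : seq T,
  forall s s', {in D, s =1 s'} -> P n s -> P n s'.

Let agree m (s t : T -> Q) := forall x, pickle x < m -> s x = t x.
Let extendable m t := forall n, exists2 s, P n s & agree m s t.

Let P_antitone n m s : n <= m -> P m s -> P n s.
Proof.
by move=> /subnK <-; elim: (m - n) => [|i IH] //= ?; apply/IH/P_anti.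
Qed.

(** Otherwise each of the finitely many values at the point of code [m] fails at some index. A
    solution at the largest of these indices takes one of the values there, and antitonicity gives a
    contradiction. *)
Let extend m t : extendable m t -> exists t', extendable m.+1 t' /\ agree m t' t.
Proof.
move=> mt; case E: (@pickle_inv T m) => [x0|]; last first.
  exists t; split=> // n; have [s Ps st] := mt n; exists s => // x.
  rewrite ltnS leq_eqVlt => /orP[/eqP xm|]; last exact: st.
  by move: E; rewrite -xm pickleK_inv.
have px0 : pickle x0 = m by have := @pickle_invK T m; rewrite E.
pose upd q x := if x == x0 then q else t x.
have upd_agree q : agree m (upd q) t.
  by move=> x; rewrite /upd; case: eqP => // ->; rewrite px0 ltnn.
apply: contrapT => no_ext.
have /choice[b Hb] q : exists n, ~ exists2 s, P n s & agree m.+1 s (upd q).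
  by apply/existsNP => ext; apply: no_ext; exists (upd q).
have [s Ps st] := mt (\max_q b q); apply: (Hb (s x0)); exists s.
  by apply: P_antitone Ps; apply: leq_bigmax.
move=> x; rewrite ltnS leq_eqVlt /upd => /orP[/eqP xm|xm].
  suff -> : x = x0 by rewrite eqxx.
  by apply: (pcan_inj (@pickleK T)); rewrite px0.
by case: eqP => [->//|_]; apply: st.
Qed.

(** König's lemma along the enumeration of [T]: prefixes are extended one point at a time, and the
    limit reads each point at the stage where it is fixed. On the finite support of [P n] the limit
    agrees with a genuine solution. *)
Lemma compactness : exists s, forall n, P n s.
Proof.
have [t0 _] := P_nonempty 0.
have /choice[nxt Hnxt] (mt : nat * (T -> Q)) : exists t',
    extendable mt.1 mt.2 -> extendable mt.1.+1 t' /\ agree mt.1 t' mt.2.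
  have [/extend[t' Ht']|] := pselect (extendable mt.1 mt.2); first by exists t'.
  by exists t0.
pose t := fix t m := if m is i.+1 then nxt (i, t i) else t0.
have ext_t m : extendable m (t m).
  elim: m => [|m IH]; last exact: (Hnxt (m, t m) IH).1.
  by move=> n; have [s Ps] := P_nonempty n; exists s.
have t_agree m i : agree m (t (m + i)) (t m).
  elim: i => [|i IH]; first by rewrite addn0.
  move=> x xm; rewrite addnS -IH //.
  by apply: (Hnxt (m + i, t (m + i)) (ext_t _)).2; apply: leq_trans (leq_addr _ _).
exists (fun x => t (pickle x).+1 x) => n.
have [D HD] := P_local n; pose m := \max_(x <- D) (pickle x).+1.
have [s Ps st] := ext_t m n; apply: HD Ps => x xD.
have xm : pickle x < m.
  by rewrite /m (big_rem x) //= leq_max leqnn.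
rewrite st // -(subnKC xm); exact: t_agree.
Qed.
End Compactness.

Section LocalRule.
Variables (d k : nat) (V : seq (cell d)).
Variable h : (size V).-tuple 'I_k.+1 -> 'I_k.+1.
Notation Q := 'I_k.+1.
Notation G := (@rule_global d k V h).

Lemma rule_global_local s s' z :
  (forall v, v \in V -> s (z + v)%R = s' (z + v)%R) -> G s z = G s' z.
Proof.
move=> ss; congr h; apply: val_inj => /=.
by apply/eq_in_map => v; apply: ss.
Qed.

Lemma rule_global_shift s t z : G (fun x => s (x + t)%R) z = G s (z + t)%R.
Proof.
congr h; apply: val_inj; apply: eq_map => v /=.
by rewrite addrAC.
Qed.

Lemma finitely_surjective :
  (forall (D : seq (cell d)) (u : cell d -> Q), exists s, {in D, G s =1 u}) ->
  forall u, exists s, G s = u.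
Proof.
move=> fin u.
(* The target is imposed on more and more cells; each stage is a finite pattern and depends on
   finitely many noise cells. *)
pose P n s := forall x : cell d, pickle x < n -> G s x = u x.
have cells n : exists D : seq (cell d), forall x : cell d, pickle x < n -> x \in D.
  exists (pmap (@pickle_inv (cell d)) (iota 0 n)) => x xn.
  by rewrite mem_pmap -pickleK_inv map_f // mem_iota.
have [|n|n|s Ps] := @compactness _ _ P; last first.
- by exists s; apply: funext => x; apply: (Ps (pickle x).+1).
- have [D HD] := cells n; exists [seq (z + v)%R | z <- D, v <- V] => s s' ss Ps x xn.
  rewrite -Ps //; apply/esym/rule_global_local => v vV; apply: ss.
  by apply: allpairs_f => //; apply: HD.
- have [D HD] := cells n; have [s Hs] := fin D u.
  by exists s => x /HD; apply: Hs.
- by move=> n s Ps x xn; apply: Ps; apply: ltnW.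
Qed.
End LocalRule.

(** * Counting preimages *)

Lemma eq_card_bij (aT rT : finType) (f : aT -> rT) (A : pred aT) (B : pred rT) :
  bijective f -> (forall x, A x = B (f x)) -> #|A| = #|B|.
Proof.
move=> f_bij AB; rewrite -(on_card_preimset (onW_bij _ f_bij)).
by apply: eq_card => x; rewrite inE; apply: AB.
Qed.

Section Patterns.
Variables (T : eqType) (k : nat).
Notation Q := 'I_k.+1.
Implicit Types (X W : seq T) (a : seq Q) (P : pred (T -> Q)).

(** The value outside [X] is [ord0], as in [ext_assign], so that [npatterns] on a window matches the
    numerator of [cyl_prob]. *)
Definition extension X a (x : T) : Q := nth ord0 a (index x X).

Definition npatterns X P : nat :=
  #|[pred a : (size X).-tuple Q | P (extension X a)]|.

Lemma map_extension X a : uniq X -> size a = size X -> map (extension X a) X = a.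
Proof.
move=> Xu sa; apply: (@eq_from_nth _ ord0); rewrite size_map // => i iX.
case: X => // x0 X in Xu sa iX *.
by rewrite (nth_map x0) // /extension index_uniq.
Qed.

Lemma extension_map X (s : T -> Q) : {in X, extension X (map s X) =1 s}.
Proof.
by move=> x xX; rewrite /extension (nth_map x) ?index_mem // nth_index.
Qed.

Lemma extension_notin X a x : size a = size X -> x \notin X -> extension X a x = ord0.
Proof.
by move=> sa xX; rewrite /extension nth_default // sa leqNgt index_mem.
Qed.

Lemma npatternsT X : npatterns X xpredT = k.+1 ^ size X.
Proof.
transitivity #|{: (size X).-tuple Q}|; last by rewrite card_tuple card_ord.
exact: eq_card.
Qed.

Lemma eq_npatterns X P P' : P =1 P' -> npatterns X P = npatterns X P'.
Proof. by move=> PP; apply: eq_card => a; rewrite !inE. Qed.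

(* Exchanging the values on [B] between two patterns is an involution on
   pairs; it turns [(P f /\ P' f, g)] into [(P f', P' g')]. *)
Lemma npatterns_indep X P P' (A B : pred T) :
  uniq X -> (forall s s', {in A, s =1 s'} -> P s = P s') ->
  (forall s s', {in B, s =1 s'} -> P' s = P' s') ->
  (forall x, A x -> ~~ B x) ->
  npatterns X (predI P P') * k.+1 ^ size X = npatterns X P * npatterns X P'.
Proof.
move=> Xu PA PB AB; pose tX := (size X).-tuple Q.
pose mix (f g : tX) : tX :=
  map_tuple (fun x => if B x then extension X g x else extension X f x) (in_tuple X).
have extmix f g x : extension X (mix f g) x =
    if B x then extension X g x else extension X f x.
  have [xX|xX] := boolP (x \in X); first by rewrite extension_map.
  by rewrite !extension_notin ?size_tuple //; case: ifP.
pose swap (p : tX * tX) := (mix p.1 p.2, mix p.2 p.1).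
pose R := [predX [pred a : tX | P (extension X a)] & [pred a : tX | P' (extension X a)]].
have swapK : involutive swap.
  move=> [f g]; congr (_, _); apply: val_inj => /=.
    rewrite -[RHS](map_extension Xu (size_tuple f)).
    by apply: eq_map => x; rewrite !extmix; case: (B x).
  rewrite -[RHS](map_extension Xu (size_tuple g)).
  by apply: eq_map => x; rewrite !extmix; case: (B x).
transitivity #|R|; last by rewrite cardX.
rewrite -npatternsT -cardX; apply: (eq_card_bij (inv_bij swapK)) => -[f g].
rewrite /= !andbT; congr (_ && _).
  by apply: PA => x /AB /negPf Bx; rewrite extmix Bx.
by apply: PB => x xB; rewrite extmix (_ : B x).
Qed.

(** A pattern on [X] is a pattern on [W] and a free pattern on the rest [Z]. The equality of
    proportions is cross-multiplied to stay in [nat]. *)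
Lemma npatterns_sub X W (S : pred (seq Q)) :
  uniq X -> uniq W -> {subset W <= X} ->
  npatterns X (fun s => S (map s W)) * k.+1 ^ size W =
  #|[pred a : (size W).-tuple Q | S a]| * k.+1 ^ size X.
Proof.
move=> Xu Wu WX; pose Z := [seq x <- X | x \notin W].
have XWZ : perm_eq X (W ++ Z).
  apply: uniq_perm => //.
    rewrite cat_uniq Wu filter_uniq // andbT /=; apply/hasPn => x.
    by rewrite mem_filter => /andP[].
  move=> x; rewrite mem_cat mem_filter; have [/WX ->|] //= := boolP (x \in W).
have WZu : uniq (W ++ Z) by rewrite -(perm_uniq XWZ).
have sXWZ : size X = size W + size Z by rewrite (perm_size XWZ) size_cat.
pose tX := (size X).-tuple Q; pose tW := (size W).-tuple Q.
pose tZ := (size Z).-tuple Q.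
pose restr (a : tX) : tW * tZ :=
  (map_tuple (extension X a) (in_tuple W), map_tuple (extension X a) (in_tuple Z)).
pose join (p : tW * tZ) : tX :=
  map_tuple (extension (W ++ Z) (p.1 ++ p.2)) (in_tuple X).
have restrK : cancel restr join.
  move=> a; apply: val_inj => /=; rewrite -map_cat.
  rewrite -[RHS](map_extension Xu (size_tuple a)); apply/eq_in_map => x xX.
  by rewrite extension_map // -(perm_mem XWZ).
have joinK : cancel join restr.
  move=> [a b]; rewrite /restr /join /=.
  have abE : map (extension X (map (extension (W ++ Z) (a ++ b)) X)) (W ++ Z) = a ++ b.
    rewrite -[RHS](map_extension WZu); last by rewrite !size_cat !size_tuple.
    by apply/eq_in_map => x xWZ; rewrite extension_map // (perm_mem XWZ).
  move/eqP: abE; rewrite map_cat eqseq_cat; last by rewrite size_map size_tuple.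
  by case/andP => /eqP aE /eqP bE; congr (_, _); apply: val_inj.
rewrite sXWZ expnD [k.+1 ^ size W * _]mulnC mulnA; congr (_ * _).
rewrite -npatternsT -cardX; apply: (eq_card_bij (Bijective restrK joinK)) => a.
by rewrite /= andbT.
Qed.
End Patterns.

(** * Conditions on disjoint translates of a window *)

Section Tilings.
Variables (d k : nat).
Notation Q := 'I_k.+1.
Implicit Types (X W D E ts : seq (cell d)).

Definition translate W (t : cell d) := [seq (w + t)%R | w <- W].

Definition translates_disjoint W ts :=
  forall t t' w w', t \in ts -> t' \in ts -> w \in W -> w' \in W ->
    (w + t = w' + t')%R -> t = t'.

(** Conditions on disjoint translates are independent, so their proportions multiply; the induction
    splits off one translate at a time. *)
Lemma npatterns_tiles X W ts (S : pred (seq Q)) :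
  uniq X -> uniq W -> uniq ts -> translates_disjoint W ts ->
  (forall w t, w \in W -> t \in ts -> (w + t)%R \in X) ->
  npatterns X (fun s => all (fun t => S (map s (translate W t))) ts)
    * k.+1 ^ (size W * size ts) =
  #|[pred a : (size W).-tuple Q | S a]| ^ size ts * k.+1 ^ size X.
Proof.
move=> Xu Wu; elim: ts => [|t ts IH] /=.
  by rewrite muln0 muln1 mul1n (@eq_npatterns _ _ _ _ xpredT) // npatternsT.
move=> /andP[tts tsu] disj WX.
have tail x : x \in ts -> x \in t :: ts by rewrite inE orbC => ->.
have {}IH := IH tsu (fun _ _ _ _ tT t'T => disj _ _ _ _ (tail _ tT) (tail _ t'T))
  (fun _ _ wW tT => WX _ _ wW (tail _ tT)).
set P := fun s : cell d -> Q => S (map s (translate W t)).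
set P' := fun s : cell d -> Q => all (fun t => S (map s (translate W t))) ts.
have PE : npatterns X P * k.+1 ^ size W =
    #|[pred a : (size W).-tuple Q | S a]| * k.+1 ^ size X.
  have sW : size (translate W t) = size W by rewrite size_map.
  have Wtu : uniq (translate W t) by rewrite map_inj_uniq //; apply: addIr.
  have WtX : {subset translate W t <= X}.
    by move=> x /mapP[w wW ->]; apply: WX => //; apply: mem_head.
  by have := npatterns_sub S Xu Wtu WtX; rewrite sW.
have indep := @npatterns_indep _ k X P P' (mem (translate W t))
  (fun x => has (fun t' => x \in translate W t') ts) Xu.
have {}indep : npatterns X (predI P P') * k.+1 ^ size X = npatterns X P * npatterns X P'.
  apply: indep.
  - by move=> s s' ss; rewrite /P; congr S; apply/eq_in_map.
  - move=> s s' ss; rewrite /P'; apply: eq_in_all => t' t'T; congr S.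
    by apply/eq_in_map => x xW; apply: ss; apply/hasP; exists t'.
  - move=> x /mapP[w wW ->]; apply/hasPn => t' t'T; apply/mapP => -[w' w'W ww'].
    have tt' : t = t'.
      by apply: disj wW w'W ww'; rewrite inE ?eqxx ?t'T ?orbT.
    by rewrite tt' t'T in tts.
apply/eqP; rewrite -(eqn_pmul2r (_ : 0 < k.+1 ^ size X)) ?expn_gt0 //; apply/eqP.
rewrite mulnAC [npatterns X _ * _]indep mulnS expnD mulnACA PE IH expnS.
by rewrite mulnACA !mulnA.
Qed.

Variables (V : seq (cell d)) (h : (size V).-tuple Q -> Q).
Notation G := (@rule_global d k V h).
Hypothesis G_surj : forall e, exists c, G c = e.

Definition npreimages W D (u : cell d -> Q) :=
  npatterns W (fun s => all (fun z => G s z == u z) D).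

(* A preimage on [X] of a pattern on [E] showing [u] on every translate of [D]
   restricts to one of the patterns counted by [npreimages] on every translate of [W]. *)
Lemma tiling_bound W D E X ts u :
  uniq W -> uniq D -> uniq E -> uniq X -> uniq ts ->
  translates_disjoint W ts -> translates_disjoint D ts ->
  (forall z v, z \in D -> v \in V -> (z + v)%R \in W) ->
  (forall z v, z \in E -> v \in V -> (z + v)%R \in X) ->
  {subset E <= X} ->
  (forall w t, w \in W -> t \in ts -> (w + t)%R \in X) ->
  (forall z t, z \in D -> t \in ts -> (z + t)%R \in E) ->
  k.+1 ^ size E * k.+1 ^ (size W * size ts) <=
  npreimages W D u ^ size ts * k.+1 ^ size X * k.+1 ^ (size D * size ts).
Proof.
move=> Wu Du Eu Xu tsu Wdisj Ddisj DVW EVX EX WX DE.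
pose SF (a : seq Q) := all (fun z => G (extension W a) z == u z) D.
pose SH (a : seq Q) := a == map u D.
pose F s := all (fun t => SF (map s (translate W t))) ts.
pose H (s : cell d -> Q) := all (fun t => SH (map s (translate D t))) ts.
rewrite -(npatterns_tiles SF) // -/F mulnAC.
(* [H] prescribes exactly one pattern per translate of [D], hence the factor [1 ^ size ts]. *)
have -> : k.+1 ^ size E = npatterns E H * k.+1 ^ (size D * size ts).
  rewrite npatterns_tiles //.
  rewrite (_ : #|_| = 1) ?exp1n ?mul1n //.
  rewrite -(card1 (map_tuple u (in_tuple D))); apply: eq_card => a.
  exact: (val_eqE a (map_tuple u (in_tuple D))).
rewrite mulnAC [leqRHS]mulnAC !leq_mul2r; apply/orP; right; apply/orP; right.
(* Each pattern on [E] is sent to the restriction to [X] of a chosen preimage. This is injective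
   since the restriction already determines the image on [E]. *)
have /choice[pre Hpre] (e : (size E).-tuple Q) := G_surj (extension E e).
pose phi e : (size X).-tuple Q := map_tuple (pre e) (in_tuple X).
have Gphi e z : z \in E -> G (extension X (phi e)) z = extension E e z.
  move=> zE; rewrite -Hpre; apply: rule_global_local => v vV.
  by rewrite extension_map // EVX.
have phi_inj : injective phi.
  move=> e e' ee; apply: val_inj.
  rewrite -[LHS](map_extension Eu (size_tuple e)).
  rewrite -[RHS](map_extension Eu (size_tuple e')).
  by apply/eq_in_map => z zE; rewrite -!Gphi // ee.
rewrite /npatterns -(card_imset _ phi_inj); apply: subset_leq_card.
apply/subsetP => _ /imsetP[e He ->]; rewrite inE in He; rewrite inE.
apply/allP => t tT; have /eqP Het := allP He t tT.
apply/allP => z zD; apply/eqP.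
set s := extension X _.
transitivity (G (fun x => s (x + t)%R) z).
  apply: rule_global_local => v vV.
  by rewrite /translate -map_comp extension_map // DVW.
rewrite rule_global_shift Gphi ?DE //.
by move: Het; rewrite -map_comp => /eq_in_map; apply.
Qed.
End Tilings.

(** * Volume against surface *)

Lemma expn_increment e a b : a <= b ->
  b ^ e.+1 <= a ^ e.+1 + e.+1 * (b - a) * b ^ e.
Proof.
move=> ab; elim: e => [|e IH]; first by rewrite !expn1 expn0; lia.
rewrite expnS; apply: leq_trans (leq_mul (leqnn b) IH) _.
have step : b * a ^ e.+1 <= a ^ e.+2 + (b - a) * b ^ e.+1.
  rewrite (expnS a e.+1) -{1}(subnKC ab) mulnDl leq_add2l leq_mul2l.
  by rewrite leq_exp2r // ab orbT.
rewrite mulnDr; apply: leq_trans (leq_add step (leqnn _)) _.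
rewrite -addnA leq_add2l mulnCA -expnS -mulnDl leq_mul2r; apply/orP; right.
by rewrite mulSn.
Qed.

(** Bernoulli's inequality for [(1 + 1/h) ^ h]. *)
Lemma double_expn_le h : 0 < h -> 2 * h ^ h <= h.+1 ^ h.
Proof.
case: h => // h _; rewrite mul2n -addnn.
have bern e x : x ^ e + e * x ^ e.-1 <= x.+1 ^ e.
  elim: e => [|e IH]; first by rewrite !expn0.
  rewrite expnS /= [x.+1 ^ _]expnS; apply: leq_trans (leq_mul (leqnn _) IH).
  case: e {IH} => [|e] /=; first by rewrite !expn0; lia.
  by rewrite !expnS; nia.
by apply: leq_trans (bern _ _); rewrite /= -expnS.
Qed.

(** For [h > 0], the ratio [(h.+1 / h) ^ N] doubles every [h] factors, and [q ^ B <= 2 ^ (q * B)];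
    the hypothesis provides more than [q * B] doublings. *)
Lemma expn_ratio_unbounded h N B q :
  0 < N -> h * (q * B).+1 <= N -> h ^ N * q ^ B < h.+1 ^ N.
Proof.
case: h => [|h] N0 hN; first by rewrite exp0n // mul0n expn_gt0.
set j := N %/ h.+1.
have jB : q * B < j by rewrite /j leq_divRL // mulnC.
have qB : q ^ B < 2 ^ j.
  apply: (@leq_ltn_trans (2 ^ (q * B))); last by rewrite ltn_exp2l.
  rewrite expnM; case: B {jB hN} => // B.
  by rewrite leq_exp2r // ltnW // ltn_expl.
apply: (@leq_trans (h.+1 ^ N * 2 ^ j)); first by rewrite ltn_pmul2l // expn_gt0.
rewrite {1 2}(divn_eq N h.+1) -/j !expnD mulnAC; apply: leq_mul; last first.
  by case: (N %% h.+1) => // r; rewrite leq_exp2r.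
rewrite mulnC [j * _]mulnC !expnM -expnMn; case: (j) => // i.
by rewrite leq_exp2r // double_expn_le.
Qed.

Lemma box_growth d h q R : 0 < d ->
  let L := R.*2.+1 in exists n,
  h ^ (n.*2.+1 ^ d) * q.+1 ^ ((L * n + R.*2).*2.+1 ^ d) <
  q.+1 ^ ((L * n + R).*2.+1 ^ d) * h.+1 ^ (n.*2.+1 ^ d).
Proof.
case: d => // e _ L.
(* The shell between the two boxes has thickness [b - a = R.*2] and, as [b <= m * L.*2], volume at
   most [C * m ^ e]. The choice of [n] makes [m ^ e.+1] large enough for [expn_ratio_unbounded]. *)
pose C := e.+1 * R.*2 * L.*2 ^ e; pose n := h * (q.+1 * C).+1; exists n.
set m := n.*2.+1; set b := _.*2.+1; set a := (_ + R).*2.+1.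
have ab : a <= b by rewrite /a /b; lia.
have bm : b <= m * L.*2.
  rewrite /b /m /L; nia.
have me0 : 0 < m ^ e by rewrite expn_gt0.
have bB : b ^ e.+1 <= a ^ e.+1 + C * m ^ e.
  apply: leq_trans (expn_increment e ab) _; rewrite leq_add2l.
  rewrite (_ : b - a = R.*2); last by rewrite /a /b; lia.
  rewrite /C -(mulnA _ (L.*2 ^ e)) -expnMn leq_mul2l; apply/orP; right.
  by case: (e) => // i; rewrite leq_exp2r // mulnC.
apply: (@leq_ltn_trans (h ^ m ^ e.+1 * (q.+1 ^ (C * m ^ e) * q.+1 ^ a ^ e.+1))).
  by rewrite leq_mul2l -expnD leq_pexp2l ?orbT // addnC.
rewrite mulnA mulnC ltn_pmul2l ?expn_gt0 //.
apply: expn_ratio_unbounded; first by rewrite expn_gt0.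
rewrite expnS; apply: (@leq_trans (n * m ^ e)); last first.
  by rewrite leq_mul2r /m; apply/orP; right; lia.
rewrite /n -mulnA leq_mul2l; apply/orP; right.
by rewrite [leqRHS]mulSn mulnA -add1n leq_add2r.
Qed.

(** Distinct multiples are at least [R.*2.+1] apart, while [a] and [b] differ by at most [R.*2]. *)
Lemma far_multiples_eq (R : nat) (x y a b : int) :
  absz a <= R -> absz b <= R ->
  (a + x *+ R.*2.+1 = b + y *+ R.*2.+1)%R -> x = y.
Proof.
have mulrnE (z : int) n : (z *+ n = z * n%:Z)%R by rewrite -mulr_natr natz.
move=> aR bR; rewrite !mulrnE.
have [->//|xy] := eqVneq x y => e.
have [lt|lt] : (x + 1 <= y \/ y + 1 <= x)%R by lia.
  have := ler_wpM2r (_ : 0 <= Posz R.*2.+1)%R lt; lia.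
have := ler_wpM2r (_ : 0 <= Posz R.*2.+1)%R lt; lia.
Qed.

(** * Boxes and sparse translates *)

Section Boxes.
Variable d : nat.

Definition box m : seq (cell d) :=
  [seq (\row_i ((nat_of_ord (f i))%:Z - m%:Z))%R
  | f : {ffun 'I_d -> 'I_(m.*2.+1)}].

Lemma size_box m : size (box m) = m.*2.+1 ^ d.
Proof. by rewrite size_map -cardE card_ffun !card_ord. Qed.

Lemma box_uniq m : uniq (box m).
Proof.
rewrite map_inj_uniq ?enum_uniq // => f g /rowP fg.
apply/ffunP => i; apply: val_inj => /=; have := fg i; rewrite !mxE; lia.
Qed.

Lemma mem_box m (z : cell d) :
  reflect (forall i, absz (z 0%R i) <= m) (z \in box m).
Proof.
apply: (iffP mapP) => [[f _ ->] i|zm].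
  rewrite mxE; have := ltn_ord (f i); move: (nat_of_ord _) => j; lia.
have fi i : absz (z 0%R i + m%:Z)%R < m.*2.+1 by have := zm i; lia.
exists [ffun i => Ordinal (fi i)]; first by rewrite mem_enum.
apply/rowP => i; rewrite mxE ffunE /=; have := zm i; lia.
Qed.

Lemma box_bound (W : seq (cell d)) : exists m, {subset W <= box m}.
Proof.
exists (\max_(z <- W) \max_i absz (z 0%R i)) => z zW; apply/mem_box => i.
rewrite (big_rem z) //= leq_max; apply/orP; left.
exact: (leq_bigmax (F := fun i => absz (z 0%R i))).
Qed.

Lemma mem_boxD m n (y z : cell d) :
  y \in box m -> z \in box n -> (y + z)%R \in box (m + n).
Proof.
move=> /mem_box ym /mem_box zn; apply/mem_box => i; rewrite mxE.
by move: (ym i) (zn i); move: (y _ _) (z _ _) => a b; lia.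
Qed.

Lemma mem_boxMn m n (z : cell d) : z \in box m -> (z *+ n)%R \in box (n * m).
Proof.
move=> zm; elim: n => [|n IH]; first by rewrite mulr0n; apply/mem_box => i; rewrite mxE.
by rewrite mulrS mulSn; apply: mem_boxD.
Qed.

Lemma box_sub m n : m <= n -> {subset box m <= box n}.
Proof.
by move=> mn z /mem_box zm; apply/mem_box => i; apply: leq_trans mn.
Qed.

Lemma box_translates_disjoint R n W : {subset W <= box R} ->
  translates_disjoint W [seq (t *+ R.*2.+1)%R | t <- box n].
Proof.
move=> WR _ _ w w' /mapP[t _ ->] /mapP[t' _ ->] /WR/mem_box wR /WR/mem_box w'R.
move/rowP => ww'; congr (_ *+ _)%R; apply/rowP => i.
have := ww' i; rewrite ![in X in X -> _]mxE !mulmxnE.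
exact: far_multiples_eq (wR i) (w'R i).
Qed.
End Boxes.

(** * Balance of surjective rules *)

Section Balance.
Variables (d k : nat) (V : seq (cell d)) (h : (size V).-tuple 'I_k.+1 -> 'I_k.+1).
Notation Q := 'I_k.+1.
Notation G := (@rule_global d k V h).
Hypothesis d_gt0 : 0 < d.
Hypothesis G_surj : forall e, exists c, G c = e.
Variables (W D : seq (cell d)).
Hypotheses (Wu : uniq W) (Du : uniq D).
Hypothesis DVW : forall z v, z \in D -> v \in V -> (z + v)%R \in W.

(* With M = (k+1)^|W|, fewer than the average means p * (k+1)^|D| <= M - 1; the
   tiling bound then reads M^N <= (M-1)^N (k+1)^(|X|-|E|) for N translates. *)
Lemma npreimages_ge u :
  k.+1 ^ size W <= npreimages h W D u * k.+1 ^ size D.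
Proof.
set p := npreimages _ _ _ _; rewrite leqNgt; apply/negP => lt.
(* With a common radius, the spacing [R.*2.+1] separates the translates of both [W] and [D], and
   reading [V] enlarges a box by [R]. *)
have [R HR] := box_bound (W ++ D ++ V).
have WR : {subset W <= box d R} by move=> x xW; apply: HR; rewrite mem_cat xW.
have DR : {subset D <= box d R} by move=> x xD; apply: HR; rewrite !mem_cat xD orbT.
have VR : {subset V <= box d R} by move=> x xV; apply: HR; rewrite !mem_cat xV !orbT.
have [hM hME] : exists hM, k.+1 ^ size W = hM.+1.
  by exists (k.+1 ^ size W).-1; rewrite prednK // expn_gt0.
have [n] := box_growth hM k R d_gt0.
set L := R.*2.+1; set N := n.*2.+1 ^ d; apply/negP; rewrite -leqNgt.
pose ts := [seq (t *+ L)%R | t <- box d n].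
have sts : size ts = N by rewrite size_map size_box.
have tsu : uniq ts.
  rewrite map_inj_uniq ?box_uniq // => x y /rowP xy; apply/rowP => i.
  have := xy i; rewrite !mulmxnE => e.
  by apply: (@far_multiples_eq R _ _ 0%R 0%R) => //; rewrite e.
have ts_box t : t \in ts -> t \in box d (L * n).
  by move=> /mapP[x xn ->]; apply: mem_boxMn.
pose E := box d (L * n + R); pose X := box d (L * n + R.*2).
have bound := @tiling_bound d k V h G_surj W D E X ts u Wu Du (box_uniq _ _)
  (box_uniq _ _) tsu (box_translates_disjoint WR) (box_translates_disjoint DR) DVW.
have {bound} := bound _ _ _ _; rewrite !size_box sts -/p => bound.
have {}bound : k.+1 ^ (L * n + R).*2.+1 ^ d * k.+1 ^ (size W * N) <=
  p ^ N * k.+1 ^ (L * n + R.*2).*2.+1 ^ d * k.+1 ^ (size D * N).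
  apply: bound.
  - by move=> z v zE /VR vR; rewrite /X -addnn addnA; apply: mem_boxD.
  - by apply: box_sub; rewrite -addnn addnA leq_addr.
  - move=> w t /WR wR /ts_box tn; apply: box_sub (mem_boxD wR tn).
    by rewrite addnC leq_add2l -addnn leq_addr.
  - by move=> z t /DR zR /ts_box tn; rewrite addrC; apply: mem_boxD.
rewrite -hME -expnM; apply: leq_trans bound _.
rewrite mulnAC (expnM _ (size D)) -expnMn leq_mul2r; apply/orP; right.
by rewrite leq_exp2r ?expn_gt0 // -ltnS -hME.
Qed.

(** Every noise pattern on [W] is counted once, under the image it shows on [D]. *)
Lemma sum_npreimages :
  \sum_(t : (size D).-tuple Q) npreimages h W D (extension D t) = k.+1 ^ size W.
Proof.
rewrite -npatternsT /npatterns -sum1_card.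
pose img (a : (size W).-tuple Q) : (size D).-tuple Q :=
  map_tuple (G (extension W a)) (in_tuple D).
rewrite (partition_big img xpredT) //=; apply: eq_bigr => t _.
rewrite /npreimages /npatterns -sum1_card; apply: eq_bigl => a; rewrite !inE /=.
apply/allP/eqP => [at_|<- z zD].
  apply: val_inj => /=; rewrite -[RHS](map_extension Du (size_tuple t)).
  by apply/eq_in_map => z /at_ /eqP.
by rewrite /= extension_map.
Qed.

(** No count is below the average and the counts sum to the average times their number, so all are
    equal to it. *)
Lemma npreimages_balanced u :
  npreimages h W D u * k.+1 ^ size D = k.+1 ^ size W.
Proof.
pose ut : (size D).-tuple Q := map_tuple u (in_tuple D).
have -> : npreimages h W D u = npreimages h W D (extension D ut).
  apply: eq_npatterns => s; apply: eq_in_all => z zD.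
  by rewrite /ut /= extension_map.
have leif t : true -> k.+1 ^ size W <= npreimages h W D (extension D t) * k.+1 ^ size D
    ?= iff (k.+1 ^ size W == npreimages h W D (extension D t) * k.+1 ^ size D).
  by move=> _; split=> //; apply: npreimages_ge.
have [_] := leqif_sum (P := xpredT) (fun t : (size D).-tuple Q => leif t).
rewrite -big_distrl /= sum_npreimages sum_nat_const card_tuple card_ord.
by rewrite mulnC eqxx => /esym/forallP/(_ ut)/eqP.
Qed.
End Balance.

(** * Correctness *)

Section Final.
Variables (d k : nat).
Notation Q := 'I_k.+1.

Lemma rule_global_head v (V : seq (cell d)) s z :
  @rule_global d k (v :: V) (@tuple_head k _) s z = s (z + v)%R.
Proof. by []. Qed.

Lemma rule_global_head_surj v (V : seq (cell d)) (e : cell d -> Q) :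
  exists s, rule_global (V := v :: V) (@tuple_head k _) s = e.
Proof.
exists (fun x => e (x - v)%R); apply: funext => z.
by rewrite rule_global_head addrK.
Qed.

Lemma same_nondet_noise v V (g : (size (v :: V)).-tuple Q -> Q) :
  (forall e, exists c, @rule_global d k (v :: V) g c = e) <->
  same_nondet (@noise_sca d k (v :: V) g) (@noise_sca d k (v :: V) (@tuple_head k _)).
Proof.
split=> [g_surj c|same e].
  apply: funext => e; apply: propext; split=> _.
    by have [s <-] := @rule_global_head_surj v V e; exists s; apply: st_global_noise.
  by have [s <-] := g_surj e; exists s; apply: st_global_noise.
have : nondet_global (@noise_sca d k (v :: V) g) e e; last first.
  by case=> s <-; exists s; rewrite st_global_noise.
rewrite same; have [s se] := @rule_global_head_surj v V e.
by exists s; rewrite st_global_noise.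
Qed.

Lemma cyl_prob_noise V (g : (size V).-tuple Q -> Q) c D u :
  cyl_prob (@noise_sca d k V g) c D u =
  ((npreimages g (undup [seq (z + v)%R | z <- D, v <- V]) D u)%:R
    / (k.+1 ^ size (undup [seq (z + v)%R | z <- D, v <- V]))%:R)%R.
Proof.
rewrite /cyl_prob /npreimages /npatterns; congr ((_ %:R) / _)%R.
apply: eq_card => a; rewrite !inE /=; apply: eq_all => z.
by rewrite st_global_noise.
Qed.

Lemma same_stoch_noise v V (g : (size (v :: V)).-tuple Q -> Q) : 0 < d ->
  (forall e, exists c, @rule_global d k (v :: V) g c = e) <->
  same_stoch (@noise_sca d k (v :: V) g) (@noise_sca d k (v :: V) (@tuple_head k _)).
Proof.
move=> d_gt0; set hd := @tuple_head k _; have hd_surj := @rule_global_head_surj v V.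
split=> [g_surj c D u|same].
  rewrite !cyl_prob_noise; set W := undup _; congr ((_ %:R) / _)%R.
  (* [D] may contain repetitions, while balance is stated for duplicate-free domains. *)
  have undupE f : npreimages f W D u = npreimages f W (undup D) u.
    by apply: eq_npatterns => s; apply: eq_all_r => z; rewrite mem_undup.
  have DVW z w : z \in undup D -> w \in v :: V -> (z + w)%R \in W.
    by rewrite !mem_undup => zD wV; apply: allpairs_f.
  apply/eqP; rewrite -(eqn_pmul2r (_ : 0 < k.+1 ^ size (undup D))) ?expn_gt0 //.
  by rewrite !undupE !npreimages_balanced ?undup_uniq.
apply: finitely_surjective => D u; set W := undup [seq (z + w)%R | z <- D, w <- v :: V].
(* Both probabilities have the same denominator, so the counts agree. The count for the shift is
   positive, hence so is that for [g], which yields a preimage of the pattern. *)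
have /eqP := same u D u; rewrite !cyl_prob_noise -/W.
have q_neq0 : ((k.+1 ^ size W)%:R : rat) != 0%R by rewrite pnatr_eq0 -lt0n expn_gt0.
rewrite (inj_eq (mulIf _)) ?invr_neq0 // eqr_nat => /eqP gh.
have [a] : exists a, a \in [pred a : (size W).-tuple Q |
    all (fun z => rule_global g (extension W a) z == u z) D].
  apply/existsP; rewrite -[[exists x, _]]negbK negb_exists.
  apply/negP => /forallP none.
  have : npreimages g W D u = 0 by apply: eq_card0 => a; apply/negbTE/none.
  rewrite gh; apply/eqP; rewrite -lt0n; apply/card_gt0P.
  have [s Hs] := hd_surj u.
  exists (map_tuple s (in_tuple W)); rewrite inE; apply/allP => z zD.
  rewrite -Hs; apply/eqP/rule_global_local => w wV; apply: extension_map.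
  by rewrite mem_undup; apply: allpairs_f.
rewrite inE => /allP Ha; exists (extension W a) => z /Ha /eqP.
by [].
Qed.
End Final.

Theorem theorem1 (d : nat) (hd : (1 <= d)%N) :
  reduces (@det_valid d) (@det_surjective d) (@pinst_valid d) (@P_N d) /\
  reduces (@det_valid d) (@det_surjective d) (@pinst_valid d) (@P_S d).
Proof.
split; apply: reduces_noise.
- by move=> c.
(* The two rules of [no_pinst] are different constants: the image of the second is not reached by
   the first. *)
- move=> /(_ (fun=> ord0)) same.
  have : nondet_global (@noise_sca d 1 [::] (fun=> ord_max)) (fun=> ord0)
           (fun _ : cell d => ord_max).
    by exists (fun=> ord0); rewrite st_global_noise.
  rewrite -same => -[s]; rewrite st_global_noise.
  by move=> /(congr1 (fun e => e 0%R)).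
- by move=> k [|v V] g // _; apply: same_nondet_noise.
- by move=> c.
(* On a one-cell cylinder the two constants have probabilities 1 and 0; the window is empty and
   carries a single assignment. *)
- move=> /(_ (fun=> ord0) [:: 0%R] (fun=> ord0)).
  rewrite !cyl_prob_noise /= !expn0 !divr1 => /eqP; rewrite eqr_nat.
  rewrite /npreimages /npatterns.
  rewrite (eq_card (B := predT)); last by move=> a; rewrite !inE.
  by rewrite [X in _ == X]eq_card0 ?card_tuple.
- by move=> k [|v V] g // _; apply: same_stoch_noise.
Qed.
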